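(* Let $p$ be a prime and let $G$ be a finite $p$-group of rank $n$. Then $G$ has Property $II$ if and only if there exist a surjective homomorphism $\phi:F_n\to G$ and an irreducible $G$-representation $V$ with character $\chi_V:G\to\mathbb{C}$ such that for all $g\in G$ primitive with respect to $\phi$, $$\sum_{i=1}^{\mathrm{ord}(g)}\chi_V(g^i)=0.$$
   Context: The rank of a finite group $G$ is the size of a minimal generating set of $G$, i.e. the least number of elements needed to generate $G$. $F_n$ denotes the free group of rank $n$. An element $x\in F_n$ is primitive if it is part of a free basis of $F_n$. For a finite group $G$ of rank $n$ and a surjective homomorphism $\phi:F_n\to G$, an element of $G$ is primitive with respect to $\phi$ if it is the image under $\phi$ of a primitive element of $F_n$. All representations are finite-dimensional and complex. An irreducible representation $\rho:G\to\mathrm{Aut}(V)$ is imprimitive with respect to $\phi$ if $\rho(\phi(x))(v)\neq v$ for all primitive $x\in F_n$ and all nonzero $v\in V$. $G$ has Property $II_\phi$ if there exists an irreducible representation of $G$ that is imprimitive with respect to $\phi$, and $G$ has Property $II$ if it has Property $II_\phi$ for some surjective homomorphism $\phi:F_n\to G$. Here $\mathrm{ord}(g)$ is the order of $g$. *)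

(* Defs.v *)
From HB Require Import structures.
From mathcomp Require Import all_boot all_order all_algebra all_fingroup.
From mathcomp Require Import all_solvable mxrepresentation.
From mathcomp Require Import reals complex.

Set Implicit Arguments.
Unset Strict Implicit.
Unset Printing Implicit Defensive.

Import GroupScope GRing.Theory.

(* The letter (i, true) stands for the generator x_i, (i, false) for x_i^-1. *)
Definition letter (n : nat) : Type := ('I_n * bool)%type.

Definition linv n (a : letter n) : letter n := (a.1, ~~ a.2).

Definition reduced n (w : seq (letter n)) : bool :=
  sorted (fun a b => b != linv a) w.

Definition push n (a : letter n) (w : seq (letter n)) : seq (letter n) :=
  if w is b :: w' then if b == linv a then w' else a :: w else [:: a].

Record free_group (n : nat) := FreeGroup {
  fgword :> seq (letter n);
  fgwordP : reduced fgword
}.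

HB.instance Definition _ n := [isSub for @fgword n].
HB.instance Definition _ n := [Choice of free_group n by <:].

Section FreeGroup.
Variable n : nat.
Implicit Types (a b : letter n) (u v w : seq (letter n)).

Fact linvK : involutive (@linv n).
Proof. by case=> i s; rewrite /linv negbK. Qed.

Fact push_reduced a w : reduced w -> reduced (push a w).
Proof.
case: w => [|b w] //= rw; case: ifP => [_|/negbT ab] /=; last by rewrite ab.
exact: path_sorted rw.
Qed.

Fact foldr_push_reduced u v : reduced v -> reduced (foldr (@push n) v u).
Proof. by move=> rv; elim: u => //= a u; apply: push_reduced. Qed.

Fact pushK a w : reduced w -> push (linv a) (push a w) = w.
Proof.
case: w => [|b w] /= rw; first by rewrite linvK eqxx.
have [eb|_] := eqVneq b (linv a); last by rewrite /= linvK eqxx.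
case: w rw => [|c w] /=; rewrite -eb //.
by case/andP=> /negPf->.
Qed.

Fact foldr_push_push a u v : reduced u -> reduced v ->
  foldr (@push n) v (push a u) = push a (foldr (@push n) v u).
Proof.
case: u => [|b u] //= _ rv; have [->|//] := eqVneq b (linv a).
by have := @pushK (linv a) _ (foldr_push_reduced u rv); rewrite linvK => ->.
Qed.

Fact foldr_push_nil u : reduced u -> foldr (@push n) [::] u = u.
Proof.
elim: u => //= a u IHu ru; rewrite IHu; last exact: path_sorted ru.
by case: u ru {IHu} => //= b u /andP[/negPf->].
Qed.

Fact rev_linv_reduced u : reduced u -> reduced (rev (map (@linv n) u)).
Proof.
move=> ru; rewrite /reduced rev_sorted sorted_map.
apply: sub_sorted ru => a b /=; apply: contra => /eqP->.
by rewrite linvK.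
Qed.

Definition fg_one : free_group n := @FreeGroup n [::] isT.

(* Concatenation followed by free reduction. *)
Definition fg_mul (x y : free_group n) : free_group n :=
  FreeGroup (foldr_push_reduced x (fgwordP y)).

Definition fg_inv (x : free_group n) : free_group n :=
  FreeGroup (rev_linv_reduced (fgwordP x)).

Fact fg_mulA : associative fg_mul.
Proof.
case=> u ru [v rv] [w rw]; apply/val_inj => /=.
elim: u ru => //= a u IHu ru; rewrite IHu; last exact: path_sorted ru.
by rewrite foldr_push_push // foldr_push_reduced.
Qed.

Fact fg_mul1 : left_id fg_one fg_mul.
Proof. by move=> x; apply/val_inj. Qed.

Fact fg_mulx1 : right_id fg_one fg_mul.
Proof. by move=> x; apply/val_inj/foldr_push_nil/fgwordP. Qed.

Fact fg_mulV : left_inverse fg_one fg_inv fg_mul.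
Proof.
case=> u ru; apply/val_inj => /=; elim: u {ru} => //= a u IHu.
by rewrite rev_cons foldr_rcons /= linvK eqxx.
Qed.

Fact fg_mulxV : right_inverse fg_one fg_inv fg_mul.
Proof.
move=> x; have <- : fg_inv (fg_inv x) = x.
  apply/val_inj; rewrite /= map_rev revK mapK //; exact: linvK.
have -> : fg_inv (fg_inv (fg_inv x)) = fg_inv x.
  apply/val_inj; rewrite /= !map_rev !revK mapK //; exact: linvK.
exact: fg_mulV.
Qed.

End FreeGroup.

HB.instance Definition _ n := isGroup.Build (free_group n)
  (@fg_mulA n) (@fg_mul1 n) (@fg_mulx1 n) (@fg_mulV n) (@fg_mulxV n).

Definition fg_gen n (i : 'I_n) : free_group n :=
  @FreeGroup n [:: (i, true)] isT.

(* Universal property: every map from B to a group H extends uniquely to a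
   homomorphism F -> H; only the values of f on B matter. *)
Definition free_basis (F : groupType) (B : F -> Prop) : Prop :=
  forall (H : groupType) (f : F -> H),
  exists h : {multiplicative F -> H},
    (forall b, B b -> h b = f b) /\
    (forall k : {multiplicative F -> H},
       (forall b, B b -> k b = f b) -> forall x, k x = h x).

Section FreeGroupUniversal.
Variables (n : nat) (H : groupType) (f : 'I_n -> H).

Definition leval (a : letter n) : H := if a.2 then f a.1 else (f a.1)^-1.

Definition fg_eval (x : free_group n) : H :=
  foldr (fun a y => leval a * y) 1 (fgword x).

Fact fg_eval_cons a u (rau : reduced (a :: u)) (ru : reduced u) :
  fg_eval (FreeGroup rau) = leval a * fg_eval (FreeGroup ru).
Proof. by []. Qed.

Fact fg_evalM : {morph fg_eval : x y / x * y}.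
Proof.
case=> u ru y; rewrite /fg_eval /=; elim: u {ru} => [|a u IHu] /=.
  by rewrite mul1g.
rewrite -mulgA -IHu; case: (foldr _ _ u) => //= b w.
have [-> /=|//] := eqVneq b (linv a).
by rewrite mulgA /leval /=; case: a.2; rewrite /= ?mulgV ?mulVg mul1g.
Qed.

HB.instance Definition _ := isMultiplicative.Build _ _ fg_eval fg_evalM.

End FreeGroupUniversal.

(* free_group n is free of rank n. *)
Lemma free_basis_gen n : free_basis (fun x => exists i : 'I_n, x = fg_gen i).
Proof.
move=> H f; exists (fg_eval (fun i => f (fg_gen i))); split.
  by move=> _ [i ->]; rewrite /= /fg_eval /= mulg1.
move=> k kE; have k1 : k 1 = 1 by apply: (mulgI (k 1)); rewrite -gmulfM !mulg1.
case=> u ru /=; elim: u ru => [|[i s] u IHu] ru.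
  by apply: etrans k1; congr (k _); apply/val_inj.
have ru' : reduced u := path_sorted ru.
rewrite (fg_eval_cons _ ru ru') -IHu.
have kg : k (fg_gen i) = f (fg_gen i) by apply: kE; exists i.
have -> : leval (fun i => f (fg_gen i)) (i, s)
          = k (if s then fg_gen i else (fg_gen i)^-1).
  rewrite /leval /=; case: s {ru} => /=; first by rewrite -kg.
  by apply: (mulgI (k (fg_gen i))); rewrite -gmulfM -kg !mulgV k1.
rewrite -gmulfM; congr (k _); apply/val_inj.
have -> : val ((if s then fg_gen i else (fg_gen i)^-1) * FreeGroup ru')
          = push (i, s) u by case: s {ru}.
by case: u ru {IHu ru'} => //= b u /andP[/negPf->].
Qed.

Lemma fg_gen_inj n : injective (@fg_gen n).
Proof. by move=> i j /(congr1 val) []. Qed.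

Definition primitive n (x : free_group n) : Prop :=
  exists B : free_group n -> Prop, free_basis B /\ B x.

Section PropertyII.
Variables (R : realType) (gT : finGroupType) (G : {group gT}).

Definition onto n (phi : {multiplicative free_group n -> gT}) : Prop :=
  forall g, g \in G <-> exists x, phi x = g.

Definition primitive_wrt n (phi : {multiplicative free_group n -> gT})
    (g : gT) : Prop :=
  exists x, primitive x /\ phi x = g.

(* As everywhere in mxrepresentation, G acts on V = C^d, seen as row vectors,
   by right multiplication, and irreducibility refers to this action. *)
Definition imprimitive n (phi : {multiplicative free_group n -> gT}) d
    (rG : mx_representation R[i] G d) : Prop :=
  forall x, primitive x ->
  forall v : 'rV[R[i]]_d, v != 0%R -> (v *m rG (phi x))%R != v.

Definition propertyII_wrt n (phi : {multiplicative free_group n -> gT}) :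
    Prop :=
  exists d (rG : mx_representation R[i] G d),
    mx_irreducible rG /\ imprimitive phi rG.

Definition propertyII : Prop :=
  exists phi : {multiplicative free_group 'm(G) -> gT},
    onto phi /\ propertyII_wrt phi.

Definition repr_character d (rG : mx_representation R[i] G d) (g : gT) : R[i] :=
  (\tr (rG g))%R.

End PropertyII.

(* Main.v *)
Require Import Defs.
From mathcomp Require Import all_boot all_order all_algebra all_fingroup.
From mathcomp Require Import all_solvable mxrepresentation.
From mathcomp Require Import reals complex.
Import GroupScope.

(** The matrix [\sum_(1 <= i <= #[g]) rG g ^+ i] is [#[g]] times a projection
    onto the vectors fixed by [g], so its trace is [#[g] * dim V^g], which
    vanishes exactly when [g] fixes no nonzero vector. The equivalence thus
    holds for each [phi] and each representation separately. *)

Import GRing.Theory Num.Theory.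
Local Open Scope ring_scope.

(** In the rank factorization [E = col_base E *m row_base E], idempotence forces the reversed
    product to be the identity of size [\rank E]; both products have the same trace. *)
Lemma mxtrace_idempotent (F : fieldType) (d : nat) (E : 'M[F]_d) :
  E *m E = E -> \tr E = (\rank E)%:R.
Proof.
move=> idemE; have base1 : row_base E *m col_base E = 1%:M.
  apply: (row_free_inj (row_base_free E)); apply: (row_full_inj (col_base_full E)).
  by rewrite mul1mx -(mulmxA (row_base E)) mulmx_base (mulmxA (col_base E)) mulmx_base.
by rewrite -{1}(mulmx_base E) mxtrace_mulC base1 mxtrace1.
Qed.

Section CyclicAverage.
Variables (F : numFieldType) (gT : finGroupType) (G : {group gT}) (d : nat).
Variables (rG : mx_representation F G d) (g : gT).
Hypothesis Gg : g \in G.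

Let S := \sum_(1 <= i < #[g].+1) rG (g ^+ i)%g.

(** Multiplying by [rG g] shifts the exponents by one, and the top exponent [#[g].+1] wraps around
    to 1. *)
Lemma repr_cyclic_sumM : S *m rG g = S.
Proof.
rewrite /S mulmx_suml (eq_bigr (fun i => rG (g ^+ i.+1)%g)); last first.
  by move=> i _; rewrite expgSr repr_mxM ?groupX.
rewrite big_nat_recr //= [RHS]big_nat_recl //= addrC; congr (_ + _).
by rewrite expgS expg_order mulg1 expg1.
Qed.

Lemma fixed_repr_cyclic_sum (v : 'rV_d) : v *m rG g = v -> v *m S = #[g]%:R *: v.
Proof.
move=> fix_v; have fixX i : v *m rG (g ^+ i)%g = v.
  elim: i => [|i IHi]; first by rewrite expg0 repr_mx1 mulmx1.
  by rewrite expgSr repr_mxM ?groupX // mulmxA IHi.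
rewrite /S mulmx_sumr (eq_bigr (fun=> v)) => [|i _]; last exact: fixX.
by rewrite sumr_const_nat subSS subn0 scaler_nat.
Qed.

(** Each row of [S] is fixed by [g], so [S] scales it by [#[g]]. *)
Lemma repr_cyclic_sum_sqr : S *m S = #[g]%:R *: S.
Proof.
apply/row_matrixP=> i; rewrite row_mul linearZ /=.
by apply: fixed_repr_cyclic_sum; rewrite -row_mul repr_cyclic_sumM.
Qed.

Lemma sum_trace_eq0 :
  \sum_(1 <= i < #[g].+1) \tr (rG (g ^+ i)%g) = 0 <->
  forall v : 'rV_d, v != 0 -> v *m rG g != v.
Proof.
have g0 : #[g]%:R != 0 :> F by rewrite pnatr_eq0 -lt0n order_gt0.
have -> : \sum_(1 <= i < #[g].+1) \tr (rG (g ^+ i)%g) = \tr S.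
  by rewrite /S raddf_sum.
pose E := #[g]%:R^-1 *: S.
have idemE : E *m E = E.
  by rewrite /E -scalemxAl -scalemxAr repr_cyclic_sum_sqr (scalerA _ _ S) mulVf // scale1r.
have trE : \tr S = #[g]%:R * (\rank E)%:R.
  by rewrite -mxtrace_idempotent // /E mxtraceZ mulVKf.
split=> [/eqP | nofix].
  (* In characteristic 0 a zero trace means that [E] has rank 0, so [S = 0]; a fixed [v] then
     satisfies [#[g]%:R *: v = 0]. *)
  rewrite trE mulf_eq0 (negPf g0) pnatr_eq0 mxrank_eq0 scaler_eq0 invr_eq0.
  rewrite (negPf g0) /= => /eqP S0 v v0; apply/eqP=> /fixed_repr_cyclic_sum/eqP.
  by rewrite S0 mulmx0 eq_sym scaler_eq0 (negPf g0) (negPf v0).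
suff -> : S = 0 by rewrite mxtrace0.
(* A nonzero row of [S] would be a nonzero vector fixed by [g]. *)
apply/row_matrixP=> i; rewrite row0; apply/eqP/contraT=> /nofix.
by rewrite -row_mul repr_cyclic_sumM eqxx.
Qed.

End CyclicAverage.

(** Surjectivity places each [phi x] in [G], where [rG] is multiplicative, so [sum_trace_eq0]
    applies to it. *)
Lemma imprimitive_characterE (R : realType) (gT : finGroupType)
    (G : {group gT}) (n : nat) (phi : {multiplicative free_group n -> gT})
    (d : nat) (rG : mx_representation R[i] G d) :
  onto G phi ->
  imprimitive phi rG <->
  forall g, primitive_wrt phi g ->
    \sum_(1 <= i < #[g].+1) repr_character rG (g ^+ i)%g = 0.
Proof.
move=> phiG; have Gphi x : phi x \in G by apply/phiG; exists x.
split=> [impr _ [x [prim_x <-]] | sum0 x prim_x].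
  by apply/(sum_trace_eq0 _ _ _ _ rG _ (Gphi x)); apply: impr.
by apply/(sum_trace_eq0 _ _ _ _ rG _ (Gphi x)); apply: sum0; exists x.
Qed.

Local Close Scope ring_scope.

Theorem lemma10 (R : realType) (p n : nat) (gT : finGroupType)
    (G : {group gT}) :
  prime p -> p.-group G -> 'm(G) = n ->
  propertyII R G <->
  exists phi : {multiplicative free_group n -> gT},
    onto G phi /\
    exists d (rG : mx_representation R[i] G d),
      mx_irreducible rG /\
      forall g, primitive_wrt phi g ->
        (\sum_(1 <= i < #[g].+1) repr_character rG (g ^+ i) = 0)%R.
Proof.
(* Once [n] is replaced by ['m(G)], the same [phi] and [rG] serve as witnesses in both
   directions. *)
move=> _ _ <-; split=> -[phi [phiG [d [rG [irrG impr]]]]];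
  exists phi; split=> //; exists d, rG; split=> //;
  exact/(imprimitive_characterE _ _ _ _ _ _ _ phiG).
Qed.
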